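(* Let $K$ be a curve embedded into the Euclidean space $\mathbb{R}^d$ which does not lie in any hyperplane of $\mathbb{R}^d$. Let $\Pi_{1,d}|K$ be the space of restrictions to $K$ of all polynomials of degree at most $1$ on $\mathbb{R}^d$. Then $\Pi_{1,d}|K$ is a Chebyshev space if and only if $K$ is a convex curve.
   Context: A curve $K$ in $\mathbb{R}^d$ is the image of an embedding of the circle, $\sigma:S^1\to\mathbb{R}^d$ (closed curve), or of an interval, $\sigma:(a,b)\to\mathbb{R}^d$ (nonclosed curve). No smoothness is required. A hyperplane is an affine subspace of dimension $d-1$. A curve $K$ is convex if it intersects any hyperplane at no more than $d$ points counted with multiplicity. The multiplicity of an intersection point of $K$ with a hyperplane is the largest number of intersection points lying in a small neighborhood of that point after a slight perturbation of the hyperplane. A finite-dimensional space of continuous real functions on $K$ of dimension $N$ is a Chebyshev space if its bases are Chebyshev systems, i.e. if for a basis $g_1,\dots,g_N$ and any real constants $c_1,\dots,c_N$, not all zero, the function $\sum_{j=1}^N c_jg_j$ vanishes at no more than $N-1$ different points of $K$. *)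

(* Defs.v *)
From HB Require Import structures.
From mathcomp Require Import all_boot all_order all_algebra.
From mathcomp Require Import all_classical all_reals all_analysis.
(* The notations of mpoly clash with those of analysis. *)
From mathcomp Require Import -(notations) mpoly.

Set Implicit Arguments.
Unset Strict Implicit.
Unset Printing Implicit Defensive.

Import Order.TTheory GRing.Theory Num.Theory.
Import numFieldNormedType.Exports.

Local Open Scope classical_set_scope.
Local Open Scope ring_scope.

(* Euclidean space R^d is 'rV[R]_d. The library norm on it is the sup norm; it
   is used below only through the topology, which is the Euclidean one. *)

Definition embedding (X Y : topologicalType) (f : X -> Y) : Prop :=
  [/\ continuous f, injective f &
      forall U : set X, open U -> exists2 V : set Y, open V & f @^-1` V = U].

Definition unit_circle (R : realType) : set (R * R) :=
  [set z | z.1 ^+ 2 + z.2 ^+ 2 = 1].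
Arguments unit_circle : clear implicits.

Definition closed_curve (R : realType) (d : nat) (K : set 'rV[R]_d) : Prop :=
  exists2 sigma : unit_circle R -> 'rV[R]_d,
    embedding sigma & range sigma = K.

Definition nonclosed_curve (R : realType) (d : nat) (K : set 'rV[R]_d) : Prop :=
  exists (a b : R) (sigma : `]a, b[%classic -> 'rV[R]_d),
    [/\ a < b, embedding sigma & range sigma = K].

Definition curve (R : realType) (d : nat) (K : set 'rV[R]_d) : Prop :=
  closed_curve K \/ nonclosed_curve K.

(* The direction of the affine subspace is the row space of W. *)
Definition hyperplane (R : realType) (d : nat) (H : set 'rV[R]_d) : Prop :=
  exists (p : 'rV[R]_d) (W : 'M[R]_d),
    (\rank W).+1 = d /\ H = [set x | (x - p <= W)%MS].

Definition level_set (R : realType) (d : nat) (a : 'rV[R]_d) (b : R) :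
    set 'rV[R]_d :=
  [set x | \sum_(i < d) a ord0 i * x ord0 i = b].

(* The equations are normalised: rescaling them would otherwise make any two
   hyperplanes arbitrarily close. *)
Definition perturbation (R : realType) (d : nat) (delta : R)
    (H H' : set 'rV[R]_d) : Prop :=
  exists (a a' : 'rV[R]_d) (b b' : R),
    [/\ `|a| = 1 /\ `|a'| = 1, H = level_set a b, H' = level_set a' b',
        `|a' - a| < delta & `|b' - b| < delta].

(* The number of points is monotone in eps and delta, so the infimum is its
   eventual value as eps, delta -> 0+; it may be +oo. *)
Definition multiplicity (R : realType) (d : nat) (K H : set 'rV[R]_d)
    (p : 'rV[R]_d) : \bar R :=
  ereal_inf [set ereal_sup [set counting (K `&` H' `&` ball p eps) |
                            H' in perturbation delta H] |
             eps in [set eps : R | 0 < eps] &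
             delta in [set delta : R | 0 < delta]].

Definition convex_curve (R : realType) (d : nat) (K : set 'rV[R]_d) : Prop :=
  forall H : set 'rV[R]_d, hyperplane H ->
    (\esum_(p in K `&` H) multiplicity K H p <= d%:R%:E)%E.

Definition is_basis (R : realType) (T : Type) (E : set (T -> R)) (N : nat)
    (g : 'I_N -> T -> R) : Prop :=
  (forall c : 'I_N -> R,
     (forall x, \sum_(j < N) c j * g j x = 0) -> forall j, c j = 0) /\
  E = [set f | exists c : 'I_N -> R, f = (fun x => \sum_(j < N) c j * g j x)].

Definition Chebyshev_system (R : realType) (T : Type) (N : nat)
    (g : 'I_N -> T -> R) : Prop :=
  forall c : 'I_N -> R, (exists j, c j != 0) ->
    ([set x | \sum_(j < N) c j * g j x = 0] #<= `I_N.-1)%card.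

Definition Chebyshev_space (R : realType) (T : topologicalType)
    (E : set (T -> R)) : Prop :=
  [/\ forall f, E f -> continuous f,
      exists (N : nat) (g : 'I_N -> T -> R), is_basis E g &
      forall (N : nat) (g : 'I_N -> T -> R),
        is_basis E g -> Chebyshev_system g].

(* mmeasure mdeg (notation msize) is the total degree plus one (and 0 for the zero polynomial). *)
Definition poly_restr (R : realType) (k d : nat) (K : set 'rV[R]_d) :
    set (K -> R) :=
  [set f | exists2 P : mpoly d R, (mmeasure mdeg P <= k.+1)%N &
     f = (fun x : K => meval (fun i => (\val x : 'rV[R]_d) ord0 i) P)].
Arguments poly_restr {R} k {d} K _.

(* Main.v *)
Require Import Defs.
From mathcomp Require Import all_boot all_order all_algebra.
From mathcomp Require Import all_classical all_reals all_analysis.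
From mathcomp Require Import finmap ring lra.
(* The notations of mpoly clash with those of analysis. *)
From mathcomp Require Import -(notations) mpoly.

Set Implicit Arguments.
Unset Strict Implicit.
Unset Printing Implicit Defensive.

Import Order.TTheory GRing.Theory Num.Theory.
Import numFieldNormedType.Exports.

Local Open Scope classical_set_scope.
Local Open Scope ring_scope.

(* Affine functions on K are the linear combinations of u = (1, x_1, ..., x_d).
   If every nonzero combination has fewer than N = d + 1 zeros, a combination f
   cannot have zeros p_i of multiplicity m_i with sum N: by induction on
   N minus the number of p_i.  Pick i with m_i > 1.  Dropping one of the m_i
   perturbed zeros near p_i leaves N - 1 points; normalised combinations
   vanishing on them cluster at some h, and h is proportional to f, as otherwise
   a combination of f and h would vanish at one more point w and contradict the
   induction hypothesis.  A combination with exactly N - 1 zeros changes sign at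
   each of them, so f changes sign at p_j iff m_j - [j = i] is odd.  For two
   choices of i this is contradictory; if only one m_i exceeds 1, f changes sign
   at all other p_j, so a perturbation of f with m_i zeros near p_i has N zeros.
   A closed curve is reduced to an open arc by removing a point away from the
   p_i.  The converse holds because every intersection point has multiplicity at
   least 1. *)

(** * Linear combinations and their zeros *)

Definition lincomb (R : realType) (T : Type) (N : nat) (u : 'I_N -> T -> R)
    (c : 'rV[R]_N) (t : T) : R :=
  \sum_(j < N) c ord0 j * u j t.

(** The Chebyshev property of the system [u], with zeros given as duplicate-free lists so that they
    can be counted and concatenated. *)
Definition few_zeros (R : realType) (T : eqType) (N : nat)
    (u : 'I_N -> T -> R) : Prop :=
  forall c : 'rV[R]_N, c != 0 -> forall s : seq T, uniq s ->
    {in s, forall t, lincomb u c t = 0} -> (size s < N)%N.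

(* The zero p of lincomb u c has multiplicity at least m. *)
Definition mult_ge (R : realType) (N : nat) (u : 'I_N -> R -> R)
    (c : 'rV[R]_N) (p : R) (m : nat) : Prop :=
  forall e : R, 0 < e -> exists2 c' : 'rV[R]_N, `|c' - c| < e &
    exists zs : seq R, [/\ uniq zs, size zs = m &
      {in zs, forall z, `|z - p| < e /\ lincomb u c' z = 0}].

Lemma few_zeros_eq0 (R : realType) (T : eqType) (N : nat)
    (u : 'I_N -> T -> R) (c : 'rV[R]_N) (s : seq T) :
  few_zeros u -> uniq s -> (N <= size s)%N ->
  {in s, forall t, lincomb u c t = 0} -> c = 0.
Proof.
move=> few us Ns cs; apply: contraTeq Ns => c0.
by rewrite -ltnNge; exact: (few c).
Qed.

Section Lincomb.
Variables (R : realType) (T : eqType) (N : nat) (u : 'I_N -> T -> R).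

Lemma lincomb0 t : lincomb u 0 t = 0.
Proof. by apply: big1 => j _; rewrite mxE mul0r. Qed.

Lemma lincombD c c' t : lincomb u (c + c') t = lincomb u c t + lincomb u c' t.
Proof.
by rewrite /lincomb -big_split; apply: eq_bigr => j _; rewrite mxE mulrDl.
Qed.

Lemma lincombZ a c t : lincomb u (a *: c) t = a * lincomb u c t.
Proof. by rewrite /lincomb mulr_sumr; apply: eq_bigr => j _;
  rewrite mxE mulrA. Qed.

Lemma lincombN c t : lincomb u (- c) t = - lincomb u c t.
Proof. by rewrite -scaleN1r lincombZ mulN1r. Qed.

Lemma lincombB c c' t : lincomb u (c - c') t = lincomb u c t - lincomb u c' t.
Proof. by rewrite lincombD lincombN. Qed.

Lemma normr_lincomb_le c t : `|lincomb u c t| <= `|c| * \sum_(j < N) `|u j t|.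
Proof.
rewrite mulr_sumr; apply: le_trans (ler_norm_sum _ _ _) _.
apply: ler_sum => j _; rewrite normrM ler_wpM2r//.
by rewrite [X in _ <= X]/Num.norm/= mx_normrE;
  apply: (@le_bigmax _ _ _ _ (fun ij => `|c ij.1 ij.2|) (ord0, j)).
Qed.

(** Evaluation at the points of [s] is an [N] by [size s] matrix of rank less than [N], so its left
    kernel is nontrivial. *)
Lemma lincomb_vanish (s : seq T) : (size s < N)%N ->
  exists2 c : 'rV[R]_N, c != 0 & {in s, forall t, lincomb u c t = 0}.
Proof.
move=> sN; pose A := \matrix_(j < N, i < size s) u j (tnth (in_tuple s) i).
have : kermx A != 0.
  rewrite kermx_eq0 /row_free; apply: contraTneq sN => rA.
  by rewrite -leqNgt -[X in (X <= _)%N]rA rank_leq_col.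
move=> /rowV0Pn[c /sub_kermxP cA c0]; exists c => // t /(nthP t)[i si <-].
have := congr1 (fun M : 'rV_(size s) => M ord0 (Ordinal si)) cA.
rewrite !mxE => <-; apply: eq_bigr => j _.
by rewrite mxE (tnth_nth t).
Qed.

End Lincomb.

Lemma continuous_lincomb (R : realType) (T : topologicalType) (N : nat)
    (u : 'I_N -> T -> R) (c : 'rV[R]_N) :
  (forall j, continuous (u j)) -> continuous (lincomb u c).
Proof.
move=> uc t; apply: cvg_big => [|j _]; first exact: add_continuous.
by apply: cvgM; [exact: cvg_cst | exact: uc].
Qed.

(** * Sign changes of continuous functions *)

Lemma ivt_sign_change (R : realType) (f : R -> R) (a b : R) :
  continuous f -> a <= b -> f a * f b < 0 -> exists2 z, a < z < b & f z = 0.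
Proof.
move=> fc ab neg.
have fa0 : f a != 0 by apply: contraTneq neg => ->; rewrite mul0r ltxx.
have fb0 : f b != 0 by apply: contraTneq neg => ->; rewrite mulr0 ltxx.
have [||z] := @IVT R f a b 0 ab.
- exact/continuous_subspaceT.
- rewrite ge_min le_max; apply/andP; split.
  + by rewrite -implyNb -ltNge; apply/implyP => fap; apply/ltW;
    rewrite -(pmulr_rlt0 _ fap).
  + by rewrite -implyNb -ltNge; apply/implyP => fan; apply/ltW;
    rewrite -(nmulr_rlt0 _ fan).
rewrite in_itv/= => /andP[az zb] fz; exists z => //.
by rewrite !lt_neqAle az zb !andbT; apply/andP; split; apply: contra_eq_neq fz;
  [move=> <-|move=> ->].
Qed.

(** Induction on the sorted zeros: cut at [c], midway between the first zero and the next one, or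
    [b] if there is none. The first piece contributes one sign, the induction hypothesis covers the
    rest, and their product carries the positive factor [f c ^+ 2]. *)
Lemma parity_of_zeros (R : realType) (f : R -> R) (s : seq R) (a b : R) :
  continuous f -> sorted <%R s -> a < b -> {in s, forall z, a < z < b} ->
  (forall z, a <= z <= b -> f z = 0 -> z \in s) ->
  (forall y a' b', y \in s -> a <= a' -> b' <= b -> a' < y < b' ->
     {in s, forall z, a' <= z <= b' -> z = y} -> f a' * f b' < 0) ->
  0 < (-1) ^+ size s * (f a * f b).
Proof.
move=> fc; elim: s a => [|y s IH] a ss ab sab zeros change.
  rewrite expr0 mul1r ltNge le_eqVlt; apply/negP => /orP[|].
    by rewrite mulf_eq0 => /orP[]/eqP/zeros; rewrite lexx (ltW ab);
      case/(_ isT).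
  move=> /(ivt_sign_change fc (ltW ab))[z /andP[/ltW az /ltW zb] /zeros].
  by rewrite az zb; case/(_ isT).
have /andP[ay yb] := sab y (mem_head _ _).
have ys z : z \in s -> y < z.
  by move: ss => /=; rewrite lt_path_sortedE => /andP[/allP + _]; apply.
pose c := (y + head b s) / 2.
have yh : y < head b s.
  by case: s ys {IH ss sab zeros change c} => [//|x s ys]; rewrite ys ?mem_head.
have hb : head b s <= b.
  case: s sab {IH ss ys zeros change c yh} => [//|x s sab].
  have /andP[_ /ltW//] : a < x < b by apply: sab; rewrite !inE eqxx orbT.
have ch z : z \in s -> c < z.
  move=> zs; have : head b s <= z.
    case: s ss zs {IH sab ys zeros change c yh hb} => [//|x s] /=.
    rewrite lt_path_sortedE inE => /andP[_ /andP[xs _]] /predU1P[->//|zs].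
    exact/ltW/(allP xs).
  by rewrite /c; lra.
have yc : y < c by rewrite /c; lra.
have cb : c < b by rewrite /c; lra.
have fac : f a * f c < 0.
  apply: (change y); rewrite ?mem_head ?lexx ?ay ?(ltW cb)// => z.
  rewrite inE => /orP[/eqP//|/ch cz /andP[_ zc]].
  by have := lt_le_trans cz zc; rewrite ltxx.
have IHc : 0 < (-1) ^+ size s * (f c * f b).
  apply: IH => //.
  - by case: (s) ss => //= x s'; case/andP.
  - move=> z zs; rewrite ch//=.
    have /andP[_ //] : a < z < b by apply: sab; rewrite inE zs orbT.
  - move=> z /andP[cz zb] /zeros; rewrite inE zb andbT (le_trans (ltW (lt_trans
    ay yc)) cz).
    by case/(_ isT)/predU1P => // zy; move: cz; rewrite zy leNgt yc.
  - move=> x a' b' xs ca' b'b ax' uq; apply: (change x) => //.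
    + by rewrite inE xs orbT.
    + by rewrite (le_trans _ ca')// ltW// (lt_trans ay).
    + move=> z; rewrite inE => /orP[/eqP->|/uq//] /andP[a'y _].
      by have := le_trans ca' a'y; rewrite leNgt yc.
have : 0 < ((-1) ^+ size s * (f c * f b)) * - (f a * f c).
  by rewrite pmulr_rgt0// oppr_gt0.
have -> : ((-1) ^+ size s * (f c * f b)) * - (f a * f c) =
  (-1) ^+ (size s).+1 * (f a * f b) * f c ^+ 2 by rewrite exprS; ring.
by rewrite pmulr_lgt0// exprn_even_gt0//=; apply: contraTneq fac => ->;
  rewrite mulr0 ltxx.
Qed.

(** * Zeros with multiplicity on the real line *)

Section RealLine.
Variables (R : realType) (N : nat) (u : 'I_N -> R -> R).
Hypothesis u_cont : forall j, continuous (u j).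
Hypothesis u_few : few_zeros u.

(* Otherwise a small multiple of a combination vanishing at the other zeros
   could be added so as to split y into two zeros. *)
Lemma sign_change_at_zero c s y a b : c != 0 -> uniq s -> (size s).+1 = N ->
  {in s, forall t, lincomb u c t = 0} -> y \in s -> a < y < b ->
  {in s, forall z, a <= z <= b -> z = y} -> lincomb u c a * lincomb u c b < 0.
Proof.
move=> c0 us sN cs ys /andP[ay yb] onlyy.
have ab := lt_trans ay yb.
have as_ : a \notin s.
  by apply: contraTN ay => /onlyy; rewrite lexx (ltW ab) => /(_ isT)->;
    rewrite ltxx.
have bs : b \notin s.
  by apply: contraTN yb => /onlyy; rewrite lexx (ltW ab) => /(_ isT)->;
    rewrite ltxx.
have nz d x : d != 0 -> {in s, forall t, lincomb u d t = 0} -> x \notin s ->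
    lincomb u d x != 0.
  move=> d0 ds xs; apply: contra_neq d0 => dx.
  apply: (few_zeros_eq0 (s := x :: s) u_few); rewrite /= ?xs ?sN//.
  by move=> t; rewrite inE => /predU1P[->|/ds].
have fa0 := nz c a c0 cs as_; have fb0 := nz c b c0 cs bs.
rewrite ltNge; apply/negP => fab0.
have {fab0} fab : 0 < lincomb u c a * lincomb u c b.
  by rewrite lt_neqAle fab0 andbT eq_sym mulf_neq0.
(* [g] vanishes at [a] and at every zero but [y], which is [N - 1] conditions; one more zero at [y]
   would make it trivial. *)
have [|g g0 gs] := @lincomb_vanish R R N u (a :: rem y s).
  by rewrite /= size_rem// prednK ?sN//; case: (s) ys.
have gy : lincomb u g y != 0.
  apply: contra_neq g0 => gy.
  apply: (few_zeros_eq0 (s := a :: s) u_few); rewrite /= ?as_ ?sN// => t.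
  have [->//|ty] := eqVneq t y.
  by move=> ts; apply: gs; move: ts; rewrite !inE mem_rem_uniq// inE ty.
(* Subtracting [e * k] times [g] gives the value [- (e * lincomb u c b)] at [y] and keeps the value
   at [a]; [e] is so small that the value at [b] keeps its sign. As the signs at [a] and [b] agree,
   [d] has a zero on each side of [y]. *)
pose k := lincomb u c b / lincomb u g y.
pose X := lincomb u c b ^+ 2; pose Y := `|lincomb u c b * (k * lincomb u g b)|.
pose e := X / (Y + 1).
have X0 : 0 < X by rewrite exprn_even_gt0.
have Y0 : 0 <= Y by exact: normr_ge0.
have e0 : 0 < e by rewrite divr_gt0// ltr_wpDl.
have eY : e * Y < X.
  rewrite /e mulrAC ltr_pdivrMr ?ltr_wpDl// ltr_pM2l//; lra.
pose d := c - (e * k) *: g.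
have dE t : lincomb u d t = lincomb u c t - e * (k * lincomb u g t).
  by rewrite lincombB lincombZ mulrA.
have da : lincomb u d a = lincomb u c a by rewrite dE gs ?mem_head// !mulr0
  subr0.
have dy : lincomb u d y = - (e * lincomb u c b).
  by rewrite dE cs// sub0r /k divfK.
have d0 : d != 0.
  by apply: contra_neq fa0 => d0; rewrite -da d0 lincomb0.
have [|z1 /andP[az1 z1y] dz1] := ivt_sign_change (continuous_lincomb (c := d)
  u_cont) (ltW ay).
  by rewrite da dy mulrN mulrCA oppr_lt0 mulr_gt0.
have [|z2 /andP[yz2 z2b] dz2] := ivt_sign_change (continuous_lincomb (c := d)
  u_cont) (ltW yb).
  rewrite dy mulNr oppr_lt0 -mulrA pmulr_rgt0// dE mulrBr -expr2 -/X subr_gt0.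
  apply: le_lt_trans eY; rewrite mulrCA ler_pM2l//; exact: ler_norm.
have out z : a < z < b -> z != y -> z \notin rem y s.
  move=> /andP[az zb] zy; apply: contra zy => /mem_rem/onlyy.
  by rewrite (ltW az) (ltW zb) => /(_ isT)->.
have z1out : z1 \notin rem y s by rewrite out ?az1 ?(lt_trans z1y)// lt_eqF.
have z2out : z2 \notin rem y s by rewrite out ?z2b ?(lt_trans ay)// gt_eqF.
have z12 : z1 != z2 by rewrite lt_eqF// (lt_trans z1y yz2).
(* Two new zeros replace [y], so [d] has [N] zeros. *)
move/eqP: d0; apply; apply: (few_zeros_eq0 (s := [:: z1, z2 & rem y s]) u_few).
- by rewrite /= rem_uniq// andbT !inE negb_or z12 z1out z2out.
- by rewrite /= size_rem// prednK ?sN//; case: (s) ys.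
- move=> t; rewrite !inE => /or3P[/eqP->|/eqP->|ts]//.
  by rewrite dE cs ?(mem_rem ts)// gs ?inE ?ts ?orbT// !mulr0 subr0.
Qed.

Lemma mult_ge_leq c p m m' : (m' <= m)%N -> mult_ge u c p m -> mult_ge u c p m'.
Proof.
move=> mm' cpm e /cpm[c' cc' [zs [uzs szs zsP]]]; exists c' => //.
exists (take m' zs); split; rewrite ?take_uniq// ?size_takel ?szs//.
by move=> z /mem_take/zsP.
Qed.

(** By [normr_lincomb_le], combinations with coefficients near [c] are uniformly close to
    [lincomb u c] around [p], so a nonzero value at [p] would exclude zeros nearby. *)
Lemma mult_ge_zero c p m : (0 < m)%N -> mult_ge u c p m -> lincomb u c p = 0.
Proof.
move=> m0 cpm; apply/eqP; apply: contraT => cp0.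
pose B t := \sum_(j < N) `|u j t|.
have Bc : {for p, continuous B}.
  apply: cvg_big => [|j _]; first exact: add_continuous.
  by apply: cvg_norm; exact: u_cont.
have cB0 : 0 < `|lincomb u c p| / (2 * (B p + 1)).
  by rewrite divr_gt0 ?normr_gt0// mulr_gt0// ltr_wpDl// sumr_ge0.
have /nbhs_ballP[e1 /= e10 e1P] : \forall t \near p, B t < B p + 1.
  by apply: (cvgr_lt (B p) Bc); rewrite ltrDl.
have /nbhs_ballP[e2 /= e20 e2P] :
    \forall t \near p, `|lincomb u c p| / 2 < `|lincomb u c t|.
  apply: (@cvgr_gt _ _ (nbhs p) _ (fun t => `|lincomb u c t|) `|lincomb u c p|).
    by apply: cvg_norm; exact: continuous_lincomb.
  by have := normr_gt0 (lincomb u c p); rewrite cp0; lra.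
pose e := Num.min (Num.min e1 e2) (`|lincomb u c p| / (2 * (B p + 1))).
have e0 : 0 < e by rewrite !lt_min e10 e20.
have [c' cc' [[|z zs] [_ szs zsP]]] := cpm e e0; first by rewrite -szs in m0.
have [zp c'z] := zsP z (mem_head _ _).
have Bz : B z < B p + 1.
  by apply: e1P; rewrite /ball/= distrC (lt_le_trans zp)// !ge_min lexx.
have cz : `|lincomb u c p| / 2 < `|lincomb u c z|.
  by apply: e2P; rewrite /ball/= distrC (lt_le_trans zp)// !ge_min lexx orbT.
have : `|lincomb u (c' - c) z| <= `|c' - c| * B z by exact: normr_lincomb_le.
rewrite lincombB c'z sub0r normrN leNgt => /negP[].
apply: le_lt_trans cz; apply: le_trans (_ : e * (B p + 1) <= _).
  by apply: ler_pM; rewrite ?sumr_ge0// ltW.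
have Bp : 0 < B p + 1 by rewrite ltr_wpDl// sumr_ge0.
rewrite -ler_pdivlMr// -[X in _ <= X]mulrA -invfM ge_min; apply/orP; right.
by [].
Qed.

Lemma exists_nonzero_value c : c != 0 -> exists w, lincomb u c w != 0.
Proof.
move=> c0; apply: contrapT => /forallNP cw; move/eqP: c0; apply.
apply: (few_zeros_eq0 (s := [seq i%:R | i <- iota 0 N]) u_few).
- by rewrite map_inj_uniq ?iota_uniq// => i j /eqP; rewrite eqr_nat => /eqP.
- by rewrite size_map size_iota.
- by move=> t _; apply/eqP/negPn/negP/cw.
Qed.

Lemma size_flatten_map (T S : Type) (ps : seq T) (zs : T -> seq S) :
  size (flatten [seq zs p | p <- ps]) = (\sum_(p <- ps) size (zs p))%N.
Proof. by rewrite size_flatten sumnE !big_map. Qed.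

(* A cluster point h of unit vectors vanishing on all the perturbed zeros at
  once
   is proportional to c, since a combination of h and c vanishing at one more
   point w is zero by the last hypothesis. *)
Lemma simultaneous_perturbation c ps m i : c != 0 -> uniq ps -> i \in ps ->
  {in ps, forall p, (0 < m p)%N /\ mult_ge u c p (m p)} ->
  (\sum_(p <- ps) m p)%N = N ->
  (forall w g, w \notin ps -> lincomb u g w = 0 ->
    {in ps, forall p, mult_ge u g p (m p - (p == i))} -> g = 0) ->
  forall e, 0 < e -> exists2 h : 'rV[R]_N, `|h - c| < e &
    exists zs : R -> seq R, {in ps, forall p,
      [/\ uniq (zs p), size (zs p) = (m p - (p == i))%N &
        {in zs p, forall z, `|z - p| < e /\ lincomb u h z = 0}]}.
Proof.
move=> c0 ups ips cps smN ext.
(* Near each [p], [h] shares its zeros with some [f p] close to [c]; combinations of [h] and [f p]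
   therefore keep them. *)
pose D e (h : 'rV[R]_N) := exists (f : R -> 'rV[R]_N) (zs : R -> seq R),
  {in ps, forall p, [/\ `|f p - c| < e, uniq (zs p),
     size (zs p) = (m p - (p == i))%N &
     {in zs p, forall z, [/\ `|z - p| < e, lincomb u (f p) z = 0
       & lincomb u h z = 0]}]}.
have Dex e : 0 < e -> exists h, `|h| = 1 /\ D e h.
  move=> e0.
  have /choice[fz fzP] : forall p, exists fz : 'rV[R]_N * seq R, p \in ps ->
      [/\ `|fz.1 - c| < e, uniq fz.2, size fz.2 = m p &
        {in fz.2, forall z, `|z - p| < e /\ lincomb u fz.1 z = 0}].
    move=> p; have [pps|] := boolP (p \in ps); last by exists (0, [::]).
    by have [_ /(_ e e0)[f fc [zs [? ? ?]]]] := cps p pps; exists (f, zs).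
  (* The boolean [p == i] is read as a number: one zero is dropped at [i] and none elsewhere, which
     leaves fewer than [N] conditions on [h]. *)
  pose zs p := drop (p == i) (fz p).2.
  have [|h h0 hzs] := @lincomb_vanish R R N u (flatten [seq zs p | p <- ps]).
    rewrite size_flatten_map -smN (big_rem _ ips) [X in (_ < X)%N](big_rem _
      ips)/=.
    rewrite size_drop eqxx; have [_ _ -> _] := fzP i ips.
    have [m0 _] := cps i ips; rewrite -addSn leq_add ?subn1 ?prednK//.
    rewrite [X in (X <= _)%N]big_seq [X in (_ <= X)%N]big_seq.
    apply: leq_sum => p /mem_rem pps.
    by rewrite size_drop; have [_ _ -> _] := fzP p pps; rewrite leq_subr.
  (* Unit norm puts the [h_ n] on a compact sphere and keeps their cluster point nonzero. *)
  exists (`|h|^-1 *: h); split.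
    by rewrite normrZ normfV normr_id mulVf// normr_eq0.
  exists (fun p => (fz p).1), zs => p pps; have [fc ufz sfz fzz] := fzP p pps.
  split; rewrite ?drop_uniq ?size_drop ?sfz// => z zzs.
  have [? ?] := fzz z (mem_drop zzs); split=> //.
  rewrite lincombZ hzs ?mulr0//; apply/flattenP; exists (zs p) => //.
  exact: map_f.
have /choice[h_ h_P] : forall n, exists h, `|h| = 1 /\ D n.+1%:R^-1 h.
  by move=> n; apply: Dex.
have cpt : compact [set x : 'rV[R]_N | `|x| = 1].
  apply: bounded_closed_compact.
    by exists 1; split=> // x x1 y /= ->; exact: ltW.
  apply: (@closed_comp _ _ (fun x : 'rV[R]_N => `|x|) [set 1]) => [x _|].
    exact: norm_continuous.
  exact: closed_eq.
have Dle e e' h : e <= e' -> D e h -> D e' h.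
  move=> ee' [f [zs fzs]]; exists f, zs => p /fzs[fc ? ? zsP].
  split=> //; first exact: lt_le_trans ee'.
  by move=> z /zsP[zp ? ?]; split=> //; exact: lt_le_trans ee'.
have h_1 : (h_ @ \oo) [set x | `|x| = 1].
  by exists 0 => // n _; have [] := h_P n.
have [hc [/= hc1 hcP]] := cpt (h_ @ \oo) _ h_1.
have hcD e : 0 < e -> exists2 h, `|h - hc| < e & D e h.
  move=> e0; have De : (h_ @ \oo) (D e).
    have [k _ kP] := near_infty_natSinv_lt (PosNum e0).
    by exists k => // n /kP/= ne; have [_] := h_P n; apply: Dle; exact: ltW.
  have [h [Dh hce]] := hcP _ _ De (nbhsx_ballx hc e e0).
  by exists h => //; move: hce; rewrite mx_norm_ball /ball_/= distrC.
have [w cw] := exists_nonzero_value c0.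
have wps : w \notin ps.
  by apply: contra cw => /cps[m0 /(mult_ge_zero m0)->].
set a := lincomb u c w in cw.
pose b := lincomb u hc w.
(* The choice of [a] and [b] makes [w] a zero, and near [p] the perturbation [a *: h - b *: f p]
   vanishes on the shared zeros, so [ext] applies. *)
have g0 : a *: hc - b *: c = 0.
  apply: ext wps _ _; first by rewrite lincombB !lincombZ -/a -/b mulrC subrr.
  move=> p pps e e0.
  have ab : 0 < `|a| + `|b| + 1 by rewrite ltr_wpDl// addr_ge0.
  have [|h hhc [f [zs fzs]]] := hcD (e / (`|a| + `|b| + 1)).
    by rewrite divr_gt0.
  have [fc uzs szs zsP] := fzs p pps.
  exists (a *: h - b *: f p).
    have -> : a *: h - b *: f p - (a *: hc - b *: c) = a *: (h - hc) - b *: (f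
      p - c).
      by rewrite !scalerBr !opprB addrACA [RHS]addrACA [- _ + _ in RHS]addrC.
    apply: le_lt_trans (ler_normB _ _) _; rewrite !normrZ.
    have e'0 : 0 < e / (`|a| + `|b| + 1) by rewrite divr_gt0.
    apply: (@le_lt_trans _ _ ((`|a| + `|b|) * (e / (`|a| + `|b| + 1)))).
      by rewrite mulrDl lerD// ler_wpM2l// ltW.
    by rewrite mulrCA -subr_gt0 -{1}(mulr1 e) -mulrBr mulr_gt0// subr_gt0
      ltr_pdivrMr// mul1r ltrDl.
  exists (zs p); split=> // z /zsP[zp fz hz]; split.
    by apply: lt_le_trans zp _; rewrite ler_pdivrMr// ler_peMr ?(ltW e0)//
      lerDr addr_ge0.
  by rewrite lincombB !lincombZ fz hz !mulr0 subrr.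
have ca : a *: hc = b *: c by apply/eqP; rewrite -subr_eq0 g0.
have hc0 : hc != 0 by rewrite -normr_gt0 hc1.
have b0 : b != 0.
  apply: contraNneq hc0 => b0; move/eqP: ca.
  by rewrite b0 scale0r scaler_eq0 (negbTE cw).
have {ca} ck : c = (a / b) *: hc by rewrite mulrC -scalerA ca scalerA mulVf//
  scale1r.
(* As [c = k *: hc], for [h] close to [hc] the multiple [k *: h] is close to [c] and has the zeros
   of [h]. The [+ 1] in the denominator also keeps the tolerance below [e]. *)
move=> e e0; set k := a / b in ck.
have k0 : 0 < `|k| + 1 by rewrite ltr_wpDl.
have [|h hhc [f [zs fzs]]] := hcD (e / (`|k| + 1)); first by rewrite divr_gt0.
exists (k *: h).
  rewrite ck -scalerBr normrZ; move: hhc; rewrite ltr_pdivlMr// mulrDr mulr1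
    mulrC.
  by apply: le_lt_trans; rewrite lerDl.
exists zs => p /fzs[_ uzs szs zsP]; split=> // z /zsP[zp _ hz]; split.
  by apply: lt_le_trans zp _; rewrite ler_pdivrMr// ler_peMr ?(ltW e0)// lerDr.
by rewrite lincombZ hz mulr0.
Qed.

(** Balls of radius [r] about centres more than [r * 2] apart are disjoint. *)
Lemma uniq_flatten_separated (ps : seq R) (zs : R -> seq R) r :
  uniq ps -> {in ps &, forall p q, p != q -> r * 2 < `|p - q|} ->
  {in ps, forall p, uniq (zs p) /\ {in zs p, forall z, `|z - p| < r}} ->
  uniq (flatten [seq zs p | p <- ps]).
Proof.
elim: ps => // p ps IH /= /andP[pps ups] sep zsP.
have [uzp zpr] := zsP p (mem_head _ _).
rewrite cat_uniq uzp IH//=.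
- rewrite andbT; apply/hasPn => z /flattenP[_ /mapP[q qps ->] zq].
  apply/negP => /zpr zp.
  have pq : p != q by apply: contraNneq pps => ->.
  have qpps : q \in p :: ps by rewrite inE qps orbT.
  have [_ /(_ z zq) {}zq] := zsP q qpps.
  have := sep p q (mem_head _ _) qpps pq.
  have := ler_distD z p q; rewrite (distrC p z); lra.
- by move=> x y xps yps; apply: sep; rewrite inE ?xps ?yps orbT.
- by move=> x xps; apply: zsP; rewrite inE xps orbT.
Qed.

(** The listed zeros number [N - 1], so there is no further one and [sign_change_at_zero] applies at
    each; [parity_of_zeros] then counts those near [p]. *)
Lemma sign_parity c ps (zs : R -> seq R) r : c != 0 -> uniq ps -> 0 < r ->
  {in ps &, forall p q, p != q -> r * 2 < `|p - q|} ->
  {in ps, forall p, uniq (zs p) /\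
    {in zs p, forall z, `|z - p| < r /\ lincomb u c z = 0}} ->
  (\sum_(p <- ps) size (zs p)).+1 = N ->
  {in ps, forall p,
    0 < (-1) ^+ size (zs p) * (lincomb u c (p - r) * lincomb u c (p + r))}.
Proof.
move=> c0 ups r0 sep zsP szs p pps; rewrite -size_flatten_map in szs.
set Z := flatten _ in szs.
have uZ : uniq Z.
  apply: uniq_flatten_separated ups sep _ => q /zsP[uq qr]; split=> // z /qr[].
  by [].
have Z0 : {in Z, forall z, lincomb u c z = 0}.
  by move=> z /flattenP[_ /mapP[q /zsP[_ qP] ->] /qP[]].
have Zp z : z \in Z -> `|z - p| <= r -> z \in zs p.
  move=> /flattenP[_ /mapP[q qps ->] zq] zp.
  have [<-//|pq] := eqVneq q p.
  have := sep q p qps pps pq; have [_ /(_ z zq)[{}zq _]] := zsP q qps.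
  have := ler_distD z q p; rewrite (distrC q z); lra.
have pZ z : z \in zs p -> z \in Z.
  by move=> zp; apply/flattenP; exists (zs p) => //; exact: map_f.
have [uzp zpr] := zsP p pps.
rewrite -(size_sort <=%R); apply: parity_of_zeros.
- exact: continuous_lincomb.
- by rewrite sort_lt_sorted.
- lra.
- by move=> z; rewrite mem_sort => /zpr[]; rewrite ltr_distl.
- move=> z zp cz; rewrite mem_sort; apply: Zp; last by rewrite ler_distl.
  apply: contraT => zZ; move/eqP: c0; case.
  apply: (few_zeros_eq0 (s := z :: Z) u_few); rewrite /= ?zZ ?szs//.
  by move=> t; rewrite inE => /predU1P[->|/Z0].
- move=> y a' b'; rewrite mem_sort => yp pa' b'p ayb uq.
  apply: (sign_change_at_zero c0 uZ szs Z0 (pZ _ yp) ayb) => z zZ /andP[az zb].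
  apply: uq; rewrite ?az// mem_sort; apply: Zp => //.
  by rewrite ler_distl (le_trans pa' az) (le_trans zb b'p).
Qed.

Lemma exists_lower_bound (s : seq R) : {in s, forall x, 0 < x} ->
  exists2 r, 0 < r & {in s, forall x, r < x}.
Proof.
elim: s => [|x s IH] s0; first by exists 1.
have [|r r0 rs] := IH; first by move=> y ys; rewrite s0// inE ys orbT.
have x0 := s0 x (mem_head _ _).
exists (Num.min r (x / 2)); first by rewrite lt_min r0 divr_gt0.
move=> y; rewrite inE gt_min => /predU1P[->|/rs->//].
by apply/orP; right; lra.
Qed.

Lemma exists_separation (s : seq R) : exists2 r, 0 < r &
  {in s &, forall p q, p != q -> r * 2 < `|p - q|}.
Proof.
have [|r r0 rP] := @exists_lower_bound
    [seq x <- [seq `|p - q| / 2 | p <- s, q <- s] | 0 < x].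
  by move=> x; rewrite mem_filter => /andP[].
exists r => // p q ps qs pq; rewrite -ltr_pdivlMr//; apply: rP.
rewrite mem_filter divr_gt0 ?normr_gt0 ?subr_eq0//=.
by apply/allpairsP; exists (p, q).
Qed.

Lemma finite_zeros c : c != 0 ->
  exists s : seq R, forall t, lincomb u c t = 0 -> t \in s.
Proof.
move=> c0; pose A := [set t | lincomb u c t = 0].
have [fA|/(infinite_set_fset N)[B BA NB]] := pselect (finite_set A).
  exists (enum_fset (fset_set A)) => t At.
  have : t \in fset_set A by rewrite in_fset_set; [exact: mem_set|].
  by [].
move/eqP: c0; case; apply: few_zeros_eq0 u_few _ NB _; first exact: fset_uniq.
by move=> t tB; exact: BA.
Qed.

Lemma same_sign_nearby c (s : seq R) : {in s, forall t, lincomb u c t != 0} ->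
  exists2 e, 0 < e & forall h, `|h - c| < e ->
    {in s, forall t, 0 < lincomb u h t * lincomb u c t}.
Proof.
move=> cs; pose B t := \sum_(j < N) `|u j t|.
have B0 t : 0 < B t + 1 by rewrite ltr_wpDl// sumr_ge0.
have [|e e0 eP] := @exists_lower_bound [seq `|lincomb u c t| / (B t + 1) | t <-
  s].
  by move=> _ /mapP[t /cs ct ->]; rewrite divr_gt0 ?normr_gt0.
exists e => // h hc t ts; set x := lincomb u h t; set y := lincomb u c t.
have xy : `|x - y| < `|y|.
  rewrite -lincombB; apply: le_lt_trans (normr_lincomb_le _ _ _) _.
  have := eP _ (map_f _ ts); rewrite ltr_pdivlMr//; apply: le_lt_trans.
  by rewrite ler_pM ?sumr_ge0// ?(ltW hc)// lerDl.
have [y0|y0|y0] := ltgtP 0 y; last by move: (cs t ts); rewrite -/y -y0 eqxx.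
  by move: xy; rewrite (gtr0_norm y0) ltr_distl => /andP[xy _];
    rewrite mulr_gt0//; lra.
move: xy; rewrite (ltr0_norm y0) ltr_distl => /andP[_ xy].
by rewrite nmulr_lgt0//; lra.
Qed.

(** The sum is compared with exactly [N]: after one zero is dropped, [sign_parity] needs exactly
    [N - 1] of them. *)
Lemma sum_mult_neq c ps m : c != 0 -> uniq ps ->
  {in ps, forall p, (0 < m p)%N /\ mult_ge u c p (m p)} ->
  (\sum_(p <- ps) m p)%N != N.
Proof.
have [n] := ubnP (N - size ps); elim: n c ps m => // n IH c ps m.
rewrite ltnS => Nn c0 ups cps; apply/eqP => smN.
have cps0 : {in ps, forall p, lincomb u c p = 0}.
  by move=> p /cps[m0 /(mult_ge_zero m0)].
have psN : (size ps < N)%N.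
  rewrite ltnNge; apply/negP => Nps.
  by move/eqP: c0; apply; exact: few_zeros_eq0 u_few ups Nps cps0.
(* There are fewer than [N] points, but the multiplicities sum to [N]. *)
have /hasP[i ips mi1] : has (fun p => 1 < m p)%N ps.
  apply: contraTT psN => /hasPn ps1; rewrite -leqNgt -smN -sum1_size.
  rewrite big_seq [X in (_ <= X)%N]big_seq leq_sum// => p /ps1.
  by rewrite -leqNgt.
(* [r] separates all zeros of [lincomb u c], not only those in [ps], so [p - r] and [p + r] are not
   zeros when [p] is in [ps]. *)
have [Z ZP] := finite_zeros c0.
have [r r0 sepZ] := exists_separation Z.
have sep : {in ps &, forall p q, p != q -> r * 2 < `|p - q|}.
  by move=> p q /cps0/ZP pZ /cps0/ZP qZ; exact: sepZ.
have cr p x : p \in ps -> `|p - x| = r -> lincomb u c x != 0.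
  move=> /cps0/ZP pZ px; apply/eqP => /ZP xZ.
  have pxr : p != x by rewrite -subr_eq0 -normr_gt0 px.
  by have := sepZ p x pZ xZ pxr; rewrite px; lra.
have crD p : p \in ps -> lincomb u c (p + r) != 0.
  by move=> pps; apply: cr pps _; rewrite opprD addNKr normrN gtr0_norm.
have crB p : p \in ps -> lincomb u c (p - r) != 0.
  by move=> pps; apply: cr pps _; rewrite subKr gtr0_norm.
have [|d d0 dP] := @same_sign_nearby c ([seq p + r | p <- ps] ++ [seq p - r | p
  <- ps]).
  by move=> t; rewrite mem_cat => /orP[] /mapP[p pps ->];
    [exact: crD|exact: crB].
have dD h p : `|h - c| < d -> p \in ps ->
    0 < lincomb u h (p + r) * lincomb u c (p + r).
  by move=> /dP hc pps; apply: hc; rewrite mem_cat (map_f (fun q => q + r)).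
have dB h p : `|h - c| < d -> p \in ps ->
    0 < lincomb u h (p - r) * lincomb u c (p - r).
  by move=> /dP hc pps; apply: hc; rewrite mem_cat orbC (map_f (fun q => q -
    r)).
have h_neq0 h : `|h - c| < d -> h != 0.
  move=> hc; apply/negP => /eqP h0; have := dD h i hc ips.
  by rewrite h0 lincomb0 mul0r ltxx.
have e0 : 0 < Num.min d r by rewrite lt_min d0.
have decr (j : R) : j \in ps ->
    (1 + \sum_(p <- ps) (m p - (p == j)))%N = (\sum_(p <- ps) m p)%N.
  move=> jps; rewrite !(big_rem _ jps)/= eqxx addnA subn1 add1n prednK;
    last first.
    by have [] := cps j jps.
  congr (_ + _)%N; rewrite big_seq [RHS]big_seq; apply: eq_bigr => p.
  by rewrite mem_rem_uniq// inE => /andP[/negbTE/= -> _]; rewrite subn0.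
have sgn j : j \in ps -> (1 < m j)%N -> {in ps, forall p,
    0 < (-1) ^+ (m p - (p == j)) * (lincomb u c (p - r) * lincomb u c (p + r))}.
  move=> jps mj1 p pps.
  (* The extension hypothesis is the induction hypothesis for [w :: ps]: [w] gets multiplicity 1 and
     [j] loses one, so the sum stays [N] while the list grows. *)
  have [w g wps gw gps|h hc [zs zsP]] := simultaneous_perturbation c0 ups jps
    cps smN _ e0.
    apply: contraTeq isT => g0.
    pose m' q := if q == w then 1%N else (m q - (q == j))%N.
    have m'E : {in ps, forall q, m' q = (m q - (q == j))%N}.
      by move=> q qps; rewrite /m' ifN//; apply: contraNneq wps => <-.
    have := IH g (w :: ps) m'; rewrite /= wps ups; case/(_ _ g0 isT _)/eqP.
    - by rewrite subnS prednK ?subn_gt0//; move: Nn; rewrite -(subnSK psN) ltnS.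
    - move=> q; rewrite inE => /predU1P[->|qps].
        rewrite /m' eqxx; split=> // e ?; exists g;
          first by rewrite subrr normr0.
        by exists [:: w]; split=> // z; rewrite inE => /eqP->;
          rewrite subrr normr0.
      rewrite m'E//; split; last exact: gps.
      case: eqP => [->|_]; first by rewrite subn_gt0.
      by rewrite subn0; have [] := cps q qps.
    - rewrite big_cons {1}/m' eqxx big_seq (eq_bigr _ m'E) -big_seq.
      by rewrite decr.
  have hd : `|h - c| < d by apply: lt_le_trans hc _; rewrite ge_min lexx.
  have [_ <- _] := zsP p pps.
  have := @sign_parity h ps zs r (h_neq0 _ hd) ups r0 sep _ _ p pps.
  move=> /(_ _ _)/wrap[].
  - move=> q /zsP[uq _ qP]; split=> // z /qP[zq hz]; split=> //.
    by apply: lt_le_trans zq _; rewrite ge_min lexx orbT.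
  - rewrite -smN -(decr _ jps) add1n; congr _.+1; rewrite big_seq [RHS]big_seq.
    by apply: eq_bigr => q /zsP[].
  (* [h] and [c] give the same signs at both endpoints, so the parity statement passes from [h] to
     [c]; the extra factors combine into a square. *)
  move=> hpar; have := mulr_gt0 hpar (mulr_gt0 (dB h p hd pps) (dD h p hd pps)).
  set s := _ ^+ _; set x := lincomb u h _; set y := lincomb u h _.
  set x' := lincomb u c _; set y' := lincomb u c _.
  have -> : s * (x * y) * (x * x' * (y * y')) = s * (x' * y') * (x * y) ^+ 2 by
    ring.
  rewrite pmulr_lgt0// exprn_even_gt0//= mulf_neq0//.
    by move: (dB h p hd pps); rewrite -/x; apply: contraTneq => ->;
      rewrite mul0r ltxx.
  by move: (dD h p hd pps); rewrite -/y; apply: contraTneq => ->;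
    rewrite mul0r ltxx.
have [/hasP[j jps /andP[ji mj1]]|/hasPn m1] :=
    boolP (has (fun p => (p != i) && (1 < m p)%N) ps).
  (* At [i] the exponents for the choices [j] and [i] are [m i] and [m i - 1], which give opposite
     signs. *)
  have := sgn j jps mj1 i ips; have := sgn i ips mi1 i ips.
  have -> : (m i - (i == j) = (m i - (i == i)).+1)%N.
    by rewrite eqxx [i == j]eq_sym (negbTE ji) subn0 subn1 prednK// ltnW.
  rewrite exprS mulN1r mulNr => pos; rewrite oppr_gt0 => neg.
  by have := lt_trans pos neg; rewrite ltxx.
have {}m1 p : p \in ps -> p != i -> m p = 1%N.
  move=> pps pi; have [m0 _] := cps p pps; have := m1 p pps.
  by rewrite pi/= -leqNgt => ?; apply/eqP; rewrite eqn_leq m0 andbT.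
(* [h] has [m i] zeros near [i]. At every other [p] the exponent in [sgn] is 1, so [h] changes sign
   between the endpoints and has a zero there: [N] zeros in total. *)
have [_ /(_ _ e0)[h hc [zi [uzi szi ziP]]]] := cps i ips.
have hd : `|h - c| < d by apply: lt_le_trans hc _; rewrite ge_min lexx.
have /choice[z_ z_P] : forall p, exists z, p \in ps -> p != i ->
    `|z - p| < r /\ lincomb u h z = 0.
  move=> p; have [/andP[pps pi]|] := boolP ((p \in ps) && (p != i)); last first.
    by move=> ppi; exists 0 => pps pi; rewrite pps pi in ppi.
  have := sgn i ips mi1 p pps; rewrite (negbTE pi) subn0 m1// expr1 mulN1r
    oppr_gt0.
  move=> cneg; have [|||z zp hz] := @ivt_sign_change R (lincomb u h) (p - r) (p
    + r).
  - exact: continuous_lincomb.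
  - lra.
  - have := mulr_gt0 (dB h p hd pps) (dD h p hd pps).
    by rewrite mulrACA nmulr_lgt0.
  by exists z; rewrite ltr_distl.
pose zs p := if p == i then zi else [:: z_ p].
have zsP : {in ps, forall p, uniq (zs p) /\
    {in zs p, forall z, `|z - p| < r /\ lincomb u h z = 0}}.
  move=> p pps; rewrite /zs; case: eqVneq => [->|pi].
    split=> // z /ziP[zp hz]; split=> //; apply: lt_le_trans zp _.
    by rewrite ge_min lexx orbT.
  by split=> // z; rewrite inE => /eqP->; exact: z_P.
move/eqP: (h_neq0 h hd); apply.
apply: (few_zeros_eq0 (s := flatten [seq zs p | p <- ps]) u_few).
- by apply: uniq_flatten_separated ups sep _ => p /zsP[uq pP];
  split=> // z /pP[].
- rewrite size_flatten_map -smN big_seq [X in (_ <= X)%N]big_seq.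
  apply: leq_sum => p pps; rewrite /zs; case: eqVneq => [->|pi];
    first by rewrite szi.
  by rewrite m1.
- by move=> z /flattenP[_ /mapP[p /zsP[_ pP] ->] /pP[]].
Qed.

(** Greedy choice: the head takes as much of [n] as it can. *)
Lemma exists_sum_eq (T : eqType) (ps : seq T) (m : T -> nat) n : uniq ps ->
  (n <= \sum_(p <- ps) m p)%N ->
  exists2 m' : T -> nat, forall p, (m' p <= m p)%N & (\sum_(p <- ps) m' p)%N =
    n.
Proof.
elim: ps n => [|p ps IH] n /=.
  by rewrite big_nil leqn0 => _ /eqP->; exists (fun=> 0%N); rewrite ?big_nil.
rewrite big_cons => /andP[pps ups] nm.
have [|m' m'm sm'] := IH (n - minn n (m p))%N ups.
  by rewrite leq_subLR /minn; case: ltnP => // ?; rewrite leq_addr.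
exists (fun q => if q == p then minn n (m p) else m' q).
  by move=> q; case: eqVneq => [->|_//]; rewrite geq_minr.
rewrite big_cons eqxx big_seq (eq_bigr m') -?big_seq ?sm' ?subnKC ?geq_minl//.
by move=> q qps; rewrite ifN//; apply: contraNneq pps => <-.
Qed.

(** Lower the multiplicities until they sum to exactly [N], discard the points left with 0, and
    apply [sum_mult_neq]. *)
Lemma sum_mult_lt c ps m : c != 0 -> uniq ps ->
  {in ps, forall p, mult_ge u c p (m p)} -> (\sum_(p <- ps) m p < N)%N.
Proof.
move=> c0 ups cps; rewrite ltnNge; apply/negP => /(exists_sum_eq ups)[m' m'm
  sm'].
suff /sum_mult_neq : {in [seq p <- ps | (0 < m' p)%N], forall p,
    (0 < m' p)%N /\ mult_ge u c p (m' p)}.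
  move=> /(_ c0 (filter_uniq _ ups))/eqP; apply;
    rewrite big_filter big_mkcond/= -[RHS]sm'.
  by apply: eq_bigr => p _; case: posnP => // ->.
move=> p; rewrite mem_filter => /andP[m'0 /cps cp]; split=> //.
exact: mult_ge_leq (m'm p) cp.
Qed.

End RealLine.

(** * Hyperplanes and their normalised equations *)

Lemma level_setE (R : realType) (d : nat) (a : 'rV[R]_d) (b : R) :
  level_set a b = [set x | x *m a^T = b%:M].
Proof.
apply/seteqP; split=> x; rewrite /level_set/= => E.
  apply/matrixP => i j; rewrite !ord1 !mxE mulr1n -E.
  by apply: eq_bigr => k _; rewrite mxE mulrC.
move: E => /matrixP/(_ ord0 ord0); rewrite !mxE mulr1n => <-.
by apply: eq_bigr => i _; rewrite mxE mulrC.
Qed.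

Lemma level_setZ (R : realType) (d : nat) (a : 'rV[R]_d) (b k : R) :
  k != 0 -> level_set (k *: a) (k * b) = level_set a b.
Proof.
move=> k0; rewrite !level_setE; apply/seteqP.
split=> x; rewrite /= linearZ/= -scalemxAr -scale_scalar_mx.
  by move/(scalerI k0).
by move->.
Qed.

Lemma level_set_neq0 (R : realType) (d : nat) (a : 'rV[R]_d) (b : R) :
  a != 0 -> level_set a b !=set0.
Proof.
move=> /rV0Pn[i ai]; exists ((b / a ord0 i) *: delta_mx ord0 i).
rewrite level_setE/= -scalemxAl -rowE; apply/matrixP => j k; rewrite !ord1.
by rewrite 4!mxE mulr1n divfK.
Qed.

Lemma hyperplane_level_set (R : realType) (d : nat) (a : 'rV[R]_d) (b : R) :
  a != 0 -> hyperplane (level_set a b).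
Proof.
move=> a0; have [p] := level_set_neq0 b a0; rewrite level_setE => /= pab.
exists p, (kermx a^T); split.
  rewrite mxrank_ker mxrank_tr rank_rV a0 subn1 prednK//.
  by case/rV0Pn: a0 => i _; apply: leq_trans (ltn_ord i).
apply/seteqP; split=> x /= => [xab|/sub_kermxP].
  by apply/sub_kermxP; rewrite mulmxBl xab pab subrr.
by rewrite mulmxBl pab => /eqP; rewrite subr_eq0 => /eqP.
Qed.

(** A normal vector [a] comes from the kernel of [W^T]. The row space of [W] lies in the kernel of
    [a^T] and both have rank [d - 1], so they coincide. *)
Lemma hyperplane_eq_level_set (R : realType) (d : nat) (H : set 'rV[R]_d) :
  hyperplane H -> exists (a : 'rV[R]_d) (b : R), `|a| = 1 /\ H = level_set a b.
Proof.
move=> [p [W [rW ->]]].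
have : kermx W^T != 0.
  by rewrite -mxrank_eq0 mxrank_ker mxrank_tr -{1}rW subSnn.
move=> /rowV0Pn[a /sub_kermxP aW a0].
have Wa : (W == kermx a^T)%MS.
  rewrite -(geq_leqif (mxrank_leqif_eq _)).
    by rewrite mxrank_ker mxrank_tr rank_rV a0 subn1 -{1}rW.
  by apply/sub_kermxP; rewrite -[W]trmxK -trmx_mul aW trmx0.
exists (`|a|^-1 *: a), (`|a|^-1 * (p *m a^T) ord0 ord0); split.
  by rewrite normrZ normfV normr_id mulVf// normr_eq0.
rewrite level_setZ ?invr_eq0 ?normr_eq0// level_setE.
apply/seteqP; split=> x /=; rewrite (eqmxP Wa) -mx11_scalar.
  by move/sub_kermxP; rewrite mulmxBl => /eqP; rewrite subr_eq0 => /eqP.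
by move=> xp; apply/sub_kermxP; rewrite mulmxBl xp subrr.
Qed.

(** A normalised equation is unique up to sign: [a'] kills the kernel of [a], hence is proportional
    to it. *)
Lemma level_set_inj (R : realType) (d : nat) (a a' : 'rV[R]_d) (b b' : R) :
  `|a| = 1 -> `|a'| = 1 -> level_set a b = level_set a' b' ->
  exists k, [/\ `|k| = 1, a' = k *: a & b' = k * b].
Proof.
move=> a1 a'1 E; have a0 : a != 0 by rewrite -normr_gt0 a1.
have [p pab] := level_set_neq0 b a0.
have : level_set a' b' p by rewrite -E.
move: pab (E); rewrite !level_setE => /= pab {}E pab'.
have ker (v : 'rV[R]_d) : v *m a^T = 0 -> v *m a'^T = 0.
  move=> va; have : [set x | x *m a^T = b%:M] (p + v).
    by rewrite /= mulmxDl pab va addr0.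
  rewrite E /= mulmxDl pab' => /eqP.
  by rewrite -subr_eq0 addrAC subrr add0r => /eqP.
have /rV0Pn[i ai] := a0; pose k := a' ord0 i / a ord0 i.
have coord (c : 'rV[R]_d) j : delta_mx ord0 j *m c^T = (c ord0 j)%:M.
  by rewrite -rowE; apply/matrixP => x y; rewrite !ord1 !mxE mulr1n.
have a'E : a' = k *: a.
  apply/rowP => j; rewrite mxE.
  (* This vector is killed by [a]; applying [a'] to it compares the coordinates [i] and [j]. *)
  have := ker (delta_mx ord0 j - (a ord0 j / a ord0 i) *: delta_mx ord0 i).
  rewrite !mulmxBl -!scalemxAl !coord !scale_scalar_mx divfK// subrr => /(_
    erefl).
  move=> /eqP; rewrite subr_eq0 => /eqP/matrixP/(_ ord0 ord0).
  by rewrite !mxE !mulr1n => ->; rewrite /k; field.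
exists k; split=> //.
  by move: a'1; rewrite a'E normrZ a1 mulr1.
move: pab'; rewrite a'E linearZ/= -scalemxAr pab scale_scalar_mx.
by move=> /matrixP/(_ ord0 ord0); rewrite !mxE !mulr1n.
Qed.

(** * Affine functions as linear combinations *)

(** The map [x] allows the same system to be used on [K] itself and, through a chart, on the real
    line. *)
Definition affine_basis (R : realType) (T : Type) (d : nat) (x : T -> 'rV[R]_d)
    (j : 'I_d.+1) (t : T) : R :=
  if unlift ord0 j is Some i then x t ord0 i else 1.

(* Coefficients on affine_basis of the equation of level_set a b. *)
Definition level_coef (R : realType) (d : nat) (a : 'rV[R]_d) (b : R) :
    'rV[R]_d.+1 :=
  \row_j if unlift ord0 j is Some i then a ord0 i else - b.

Lemma lincomb_affineE (R : realType) (T : Type) (d : nat) (x : T -> 'rV[R]_d) c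
  t :
  lincomb (affine_basis x) c t =
  c ord0 ord0 + \sum_(i < d) c ord0 (lift ord0 i) * x t ord0 i.
Proof.
rewrite /lincomb big_ord_recl /affine_basis unlift_none mulr1; congr (_ + _).
by apply: eq_bigr => i _; rewrite liftK.
Qed.

Lemma lincomb_level_coef (R : realType) (T : Type) (d : nat) (x : T ->
  'rV[R]_d) a b t :
  lincomb (affine_basis x) (level_coef a b) t = 0 <-> level_set a b (x t).
Proof.
rewrite lincomb_affineE /level_set/= mxE unlift_none.
under eq_bigr do rewrite mxE liftK.
by split=> [/eqP|->]; rewrite ?addNr// addrC subr_eq0 => /eqP.
Qed.

Lemma level_coefP (R : realType) (d : nat) (c : 'rV[R]_d.+1) :
  c = level_coef (\row_i c ord0 (lift ord0 i)) (- c ord0 ord0).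
Proof.
by apply/rowP => j; rewrite mxE; case: unliftP => [i ->|->];
  rewrite ?mxE ?opprK.
Qed.

Lemma level_coefB_lt (R : realType) (d : nat) (a a' : 'rV[R]_d) (b b' e : R) :
  0 < e -> `|a' - a| < e -> `|b' - b| < e ->
  `|level_coef a' b' - level_coef a b| < e.
Proof.
move=> e0 aa' bb'; rewrite [X in X < _]/Num.norm/= mx_normrE.
apply/bigmax_ltP; split=> // -[i j] _; rewrite !mxE ord1/=.
case: unliftP => [k _|_]; last by rewrite opprK addrC distrC.
apply: le_lt_trans aa'; rewrite [X in _ <= X]/Num.norm/= mx_normrE.
have := @le_bigmax _ _ _ 0 (fun ij => `|(a' - a) ij.1 ij.2|) (ord0, k).
by rewrite !mxE.
Qed.

Lemma continuous_affine_basis (R : realType) (T : topologicalType) (d : nat)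
    (x : T -> 'rV[R]_d) j :
  continuous x -> continuous (affine_basis x j).
Proof.
move=> xc t; rewrite /affine_basis; case: unliftP => [i _|_];
  last exact: cvg_cst.
exact: (continuous_comp (xc t) (@coord_continuous R 1 d ord0 i (x t))).
Qed.

(** The monomials of degree at most 1 are the constant 1 and the coordinates. *)
Lemma poly_restr1E (R : realType) (d : nat) (K : set 'rV[R]_d) :
  poly_restr 1 K =
  [set f | exists c, f = lincomb (affine_basis (fun x : K => \val x)) c].
Proof.
pose x (t : K) : 'rV[R]_d := \val t; apply/seteqP; split=> f /=.
  move=> [P P2 ->].
  have monom m : (mdeg m <= 1)%N -> exists c, forall t,
      \prod_(i < d) (x t) ord0 i ^+ m i = lincomb (affine_basis x) c t.
    rewrite leq_eqVlt ltnS leqn0 => /orP[/mdeg1P[i /eqP->]|].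
      exists (delta_mx ord0 (lift ord0 i)) => t.
      rewrite lincomb_affineE mxE/= add0r.
      rewrite (bigD1 i)//= big1 => [|k ki].
        rewrite (bigD1 i)//= big1 => [|k ki].
          by rewrite mnm1E mxE !eqxx mul1r mulr1 addr0.
        by rewrite mxE (inj_eq (lift_inj (h:=_))) (negbTE ki) mul0r.
      by rewrite mnm1E eq_sym (negbTE ki).
    rewrite mdeg_eq0 => /eqP->; exists (delta_mx ord0 ord0) => t.
    rewrite lincomb_affineE mxE !big1/= ?addr0// => [i _|i _].
      by rewrite mxE/= mul0r.
    by rewrite mnm0E expr0.
  (* An arbitrary value outside the support makes the statement total, as [choice] requires. *)
  have {}monom m : exists c, m \in msupp P -> forall t,
      \prod_(i < d) (x t) ord0 i ^+ m i = lincomb (affine_basis x) c t.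
    have [mP|_] := boolP (m \in msupp P); last by exists 0.
    have [|c cE] := monom m; last by exists c.
    by rewrite -ltnS (leq_trans _ P2)// mmeasure_mnm_lt.
  have /choice[c_ c_E] := monom.
  exists (\sum_(m <- msupp P) mcoeff m P *: c_ m); apply/funext => t.
  rewrite mevalE /lincomb.
  under [RHS]eq_bigr do rewrite summxE mulr_suml.
  rewrite exchange_big/= big_seq [RHS]big_seq; apply: eq_bigr => m mP.
  rewrite (c_E m mP) /lincomb mulr_sumr; apply: eq_bigr => j _.
  by rewrite mxE mulrA.
move=> [c ->].
exists (mpolyC d (c ord0 ord0) + \sum_(i < d) c ord0 (lift ord0 i) *: mpolyX R
  (mnm1 i)).
  apply: leq_trans (mmeasureD_le _ _ _) _; rewrite geq_max mmeasureC.
  rewrite (leq_trans (leq_b1 _))//=.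
  apply: leq_trans (mmeasure_sum _ _ _ _) _; apply/bigmax_leqP => i _.
  by apply: leq_trans (mmeasureZ_le _ _ _) _; rewrite mmeasureX ltnS;
    apply: eq_leq; exact: mdeg1.
apply/funext => t; rewrite lincomb_affineE mevalD mevalC raddf_sum/=.
by congr (_ + _); apply: eq_bigr => i _; rewrite mevalZ mevalXU.
Qed.

(** * Chebyshev spaces of affine functions *)

Lemma card_le_seqP (T : choiceType) (A : set T) (k : nat) :
  (A #<= `I_k)%card <->
  forall s : seq T, uniq s -> {in s, forall x, A x} -> (size s <= k)%N.
Proof.
split=> [Ak s us sA|sk].
  have fA : finite_set A by apply: card_le_finite Ak _; exact: finite_II.
  apply: leq_trans (geq_card_fset_set Ak); apply: uniq_leq_size us _ => x xs.
  have : x \in fset_set A by rewrite in_fset_set; [apply: mem_set; exact: sA|].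
  by [].
have [/finite_fsetP[X AX]|/(infinite_set_fset k.+1)[B BA kB]] := pselect
  (finite_set A).
  rewrite AX in sk *.
  have /card_le_eql-> : ([set` X] #= `I_(size (enum_fset X)))%card by
    exact/card_eq_fsetP.
  by rewrite card_le_II sk// fset_uniq.
have := sk (enum_fset B) (fset_uniq B) (fun x xB => BA x xB).
by move=> /(leq_trans kB); rewrite ltnn.
Qed.

(** If [N < N'], the coefficient vectors of the [u j] over [g] satisfy a nontrivial linear relation,
    which [u] inherits. *)
Lemma leq_basis_size (R : realType) (T : Type) (N N' : nat)
    (g : 'I_N -> T -> R) (u : 'I_N' -> T -> R) :
  (forall c, (forall t, lincomb u c t = 0) -> c = 0) ->
  (forall j, exists c, u j = lincomb g c) -> (N' <= N)%N.
Proof.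
move=> free /choice[c_ c_E]; rewrite leqNgt; apply/negP => NN'.
pose M := \matrix_(j < N') c_ j.
have : kermx M != 0.
  rewrite kermx_eq0 /row_free; apply: contraTneq NN' => rM.
  by rewrite -leqNgt -[X in (X <= _)%N]rM rank_leq_col.
move=> /rowV0Pn[v /sub_kermxP vM] /eqP; apply; apply: free => t.
have -> : lincomb u v t = lincomb g (v *m M) t.
  rewrite /lincomb; under [RHS]eq_bigr do rewrite mxE mulr_suml.
  rewrite exchange_big; apply: eq_bigr => j _; rewrite c_E /lincomb mulr_sumr.
  by apply: eq_bigr => k _; rewrite mxE mulrA.
by rewrite vM; apply: big1 => j _; rewrite mxE mul0r.
Qed.

Lemma lincomb_fun (R : realType) (T : Type) (N : nat) (g : 'I_N -> T -> R)
    (c : 'I_N -> R) :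
  (fun t => \sum_(j < N) c j * g j t) = lincomb g (\row_j c j).
Proof. by apply/funext => t; apply: eq_bigr => j _; rewrite mxE. Qed.

(** If the linear part is nonzero, the zero set is a hyperplane containing [K]; if it is zero, the
    combination is a constant, which a point of [K] shows to be 0. *)
Lemma affine_basis_free (R : realType) (d : nat) (K : set 'rV[R]_d) :
  K !=set0 -> (forall H : set 'rV[R]_d, hyperplane H -> ~ subset K H) ->
  forall c, (forall t, lincomb (affine_basis (fun x : K => \val x)) c t = 0) ->
    c = 0.
Proof.
move=> [p Kp] noH c; rewrite (level_coefP c).
set a := \row_i _; set b := - _ => c0.
have [a0|a0] := eqVneq a 0; last first.
  case: (noH _ (hyperplane_level_set b a0)) => x Kx.
  exact: (iffLR (lincomb_level_coef _ _ _ _) (c0 (exist _ x (mem_set Kx)))).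
have := iffLR (lincomb_level_coef _ _ _ _) (c0 (exist _ p (mem_set Kp))).
rewrite a0 /level_set/= big1 => [<-|i _]; last by rewrite mxE mul0r.
by apply/rowP => j; rewrite !mxE; case: unliftP => [i _|_]; rewrite ?mxE ?oppr0.
Qed.

(** The definition speaks of every basis, of any size. One direction specialises it to the affine
    basis; in the other, a basis has at least [d.+1] elements by [leq_basis_size], so the bound for
    [u] is enough. *)
Lemma Chebyshev_affine (R : realType) (d : nat) (K : set 'rV[R]_d) :
  K !=set0 -> (forall H : set 'rV[R]_d, hyperplane H -> ~ subset K H) ->
  Chebyshev_space (poly_restr 1 K) <->
  few_zeros (affine_basis (fun x : K => \val x)).
Proof.
move=> K0 noH; set u := affine_basis _; have free := affine_basis_free K0 noH.
rewrite poly_restr1E -/u.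
have basis : is_basis [set f | exists c, f = lincomb u c] u.
  split=> [c c0 j|].
    have /rowP/(_ j) : \row_k c k = 0.
      by apply: free => t; rewrite -/u -lincomb_fun c0.
    by rewrite !mxE.
  apply/seteqP; split=> f /= [c ->].
    exists (fun j => c ord0 j); rewrite lincomb_fun; congr lincomb.
    by apply/rowP => j; rewrite mxE.
  by exists (\row_j c j); rewrite lincomb_fun.
split=> [[_ _ cheb] c c0 s us cs|few].
  have /rV0Pn[j cj] := c0.
  have /card_le_seqP/(_ s us) sd := cheb _ _ basis (fun j => c ord0 j)
    (ex_intro _ j cj).
  by rewrite ltnS; apply: sd => t /cs.
split=> [f [c ->]||N g gbasis c [j cj]].
- by apply: continuous_lincomb => j; apply: continuous_affine_basis;
  exact: initial_continuous.
- by exists d.+1, u.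
have dN : (d.+1 <= N)%N.
  apply: (leq_basis_size (g := g) free) => i.
  have : [set f | exists c, f = lincomb u c] (u i).
    exists (delta_mx ord0 i); apply/funext => t; rewrite /lincomb (bigD1 i)//=.
    rewrite mxE !eqxx mul1r big1 ?addr0// => k ki.
    by rewrite mxE (negbTE ki) mul0r.
  case: gbasis => _ -> [c' uE]; exists (\row_j c' j).
  by rewrite -lincomb_fun.
apply/card_le_seqP => s us sc.
have [c' c'E] : [set f | exists c, f = lincomb u c] (fun t => \sum_(j < N) c j
  * g j t).
  by case: gbasis => _ ->; exists c.
rewrite -ltnS (leq_trans _ (_ : (d.+1 <= N.-1.+1)%N))//;
  last by rewrite (leq_trans dN)// leqSpred.
apply: (few c') => // [|t /sc/=].
  apply: contra_neq cj => c'0; case: gbasis => gfree _; apply: gfree => t.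
  by have := congr1 (fun f => f t) c'E; rewrite c'0 lincomb0.
by move=> <-; rewrite -c'E.
Qed.

(** * Convexity bounds the number of zeros *)

Lemma counting_ge1 (R : realType) (T : choiceType) (A : set T) (p : T) :
  A p -> (1%:E <= counting A :> \bar R)%E.
Proof.
move=> Ap; rewrite /counting; case: asboolP => [fA|_]; last exact: leey.
rewrite lee_fin ler1n lt0n; apply/negP => /eqP/size0nil s0.
have : p \in fset_set A by rewrite in_fset_set; [exact: mem_set|].
by rewrite -[_ \in _]/(p \in enum_fset _) s0.
Qed.

Lemma counting_le (R : realType) (T : choiceType) (A : set T) (m : nat) :
  (forall s : seq T, uniq s -> {in s, forall x, A x} -> (size s <= m)%N) ->
  (counting A <= m%:R%:E :> \bar R)%E.
Proof.
move=> /card_le_seqP Am; rewrite /counting asboolT.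
  by rewrite lee_fin ler_nat geq_card_fset_set.
by apply: card_le_finite Am _; exact: finite_II.
Qed.

(** The hyperplane is a perturbation of itself, and [p] lies in every ball about [p]. *)
Lemma multiplicity_ge1 (R : realType) (d : nat) (K : set 'rV[R]_d) a b p :
  `|a| = 1 -> K p -> level_set a b p ->
  (1%:E <= multiplicity K (level_set a b) p)%E.
Proof.
move=> a1 Kp pab; apply: le_ereal_inf_tmp => _ [e /= e0 [d' /= d0 <-]].
apply: le_ereal_sup_tmp.
exists (counting (K `&` level_set a b `&` ball p e)).
  by exists (level_set a b) => //; exists a, a, b, b; rewrite !subrr !normr0.
by apply: (@counting_ge1 _ _ _ p); split; [split|exact: ballxx].
Qed.

Lemma convex_few_zeros (R : realType) (d : nat) (K : set 'rV[R]_d) :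
  convex_curve K -> few_zeros (affine_basis (fun x : K => \val x)).
Proof.
move=> cvx c c0 s us cs.
rewrite (level_coefP c) in c0 cs; move: c0 cs.
set a := \row_i _; set b := - _ => c0 cs.
have sab t : t \in s -> level_set a b (\val t).
  by move=> /cs/lincomb_level_coef.
(* With zero linear part, a single zero makes the constant term vanish too, against [c0]. *)
have [a0|a0] := eqVneq a 0.
  case: s us cs sab => // t s _ _ /(_ t (mem_head _ _)).
  rewrite a0 /level_set/= big1 => [b0|i _]; last by rewrite mxE mul0r.
  case/eqP: c0; rewrite a0 -b0.
  by apply/rowP => j; rewrite !mxE; case: unliftP => [i _|_];
    rewrite ?mxE ?oppr0.
have na0 : `|a| != 0 by rewrite normr_eq0.
rewrite -(@level_setZ _ _ a b `|a|^-1) ?invr_eq0// in sab.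
set H := level_set _ _ in sab.
have a1 : `| `|a|^-1 *: a| = 1 by rewrite normrZ normfV normr_id mulVf.
have := cvx H (hyperplane_level_set _ _).
rewrite scaler_eq0 invr_eq0 (negbTE na0) (negbTE a0) => /(_ isT).
rewrite ltnS -(ler_nat R) -lee_fin; apply: le_trans.
apply: esum_ge; exists [set` map \val s].
  split; first by apply/finite_seqP; exists (map \val s).
  by move=> _ /= /mapP[t ts ->]; split; [apply: set_mem;
    exact: valP|exact: sab].
rewrite -fsbig_seq ?(map_inj_uniq val_inj)//.
rewrite big_map -sum1_size natr_sum -sumEFin big_seq [X in (_ <= X)%E]big_seq.
apply: lee_sum => t ts; apply: multiplicity_ge1 => //; last exact: sab.
by apply: set_mem; exact: valP.
Qed.

(** * Charts of curves by the real line *)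

(* The last clause says that gamma parametrises the whole of K near each of its
   points, with a continuous inverse. *)
Definition line_chart (R : realType) (d : nat) (K : set 'rV[R]_d)
    (gamma : R -> 'rV[R]_d) : Prop :=
  [/\ continuous gamma, injective gamma, (forall t, K (gamma t)) &
    forall t e, 0 < e -> exists2 r, 0 < r & forall x, K x ->
      `|x - gamma t| < r -> exists2 t', gamma t' = x & `|t' - t| < e].

(** As [sigma] is an embedding, [U] is the preimage of an open set of the ambient space, and a ball
    inside that set supplies the radius. *)
Lemma line_chart_embedding (R : realType) (d : nat) (Y : topologicalType)
    (sigma : Y -> 'rV[R]_d) (rho : R -> Y) :
  embedding sigma -> continuous rho -> injective rho ->
  (forall t e, 0 < e -> exists U : set Y, [/\ open U, U (rho t) &
     forall y, U y -> exists2 t', rho t' = y & `|t' - t| < e]) ->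
  line_chart (range sigma) (sigma \o rho).
Proof.
move=> [sc si so] rc ri rU; split.
- by move=> t; apply: continuous_comp; [exact: rc|exact: sc].
- exact: inj_comp.
- by move=> t; exists (rho t).
move=> t e /(rU t)[U [oU Ut tU]]; have [V oV VU] := so U oU.
have /nbhs_ballP[r r0 rV] : nbhs (sigma (rho t)) V.
  by apply: open_nbhs_nbhs; split=> //; rewrite -VU in Ut.
exists r => // _ [y _ <-] yr; have /tU[t' <- ?] : U y.
  by rewrite -VU; apply: rV; rewrite mx_norm_ball /ball_/= distrC.
by exists t'.
Qed.

(** The rescaled arctangent [f] is an increasing bijection from the line onto the interval. *)
Lemma line_chart_interval (R : realType) (d : nat) (a b : R)
    (sigma : `]a, b[%classic -> 'rV[R]_d) :
  a < b -> embedding sigma ->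
  exists2 gamma, line_chart (range sigma) gamma & range gamma = range sigma.
Proof.
move=> ab se; pose f t := a + (b - a) * (atan t / pi + 2^-1).
have pi0 := pi_gt0 R.
have fI t : f t \in `]a, b[%classic.
  have := atan_ltpi2 t; have := atan_gtNpi2 t => h1 h2.
  have q : 0 < atan t / pi + 2^-1 < 1.
    rewrite -(ltrBlDr) sub0r ltr_pdivlMr// -ltrBrDr ltr_pdivrMr//; lra.
  move: q; set q := atan t / pi + 2^-1 => /andP[q0 q1].
  apply: mem_set; rewrite /= in_itv/= /f -/q; apply/andP; split; nra.
have f_lt : {homo f : x y / x < y}.
  move=> x y xy; rewrite /f ltrD2l ltr_pM2l ?subr_gt0// ltrD2r ltr_pM2r
    ?invr_gt0//.
  exact: lt_atan.
have f_lt' := leW_mono (le_mono f_lt).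
have f_onto y : a < y < b -> exists t, f t = y.
  move=> /andP[ay yb]; exists (tan (pi * ((y - a) / (b - a) - 2^-1))).
  have q : 0 < (y - a) / (b - a) < 1 by rewrite divr_gt0 ?subr_gt0//
    ltr_pdivrMr ?subr_gt0//; lra.
  rewrite /f tanK; first by field; apply/andP; split; lra.
  move: q; set q := (y - a) / (b - a) => /andP[q0 q1].
  by rewrite in_itv/=; apply/andP; split; nra.
have fc : continuous f.
  move=> t; apply: cvgD; first exact: cvg_cst.
  apply: cvgMr; apply: cvgD; last exact: cvg_cst.
  by apply: cvgMl; exact: continuous_atan.
pose rho t : `]a, b[%classic := exist _ (f t) (fI t).
have rhoE y t : f t = \val y -> rho t = y by move=> E; apply: val_inj.
exists (sigma \o rho).
  apply: line_chart_embedding => //.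
  - exact: continuous_comp_initial.
  - by move=> s t /(congr1 \val)/=; exact: (inc_inj (le_mono f_lt)).
  - move=> t e e0; exists (\val @^-1` [set` `]f (t - e), f (t + e)[]); split.
    + apply: open_comp; last exact: interval_open.
      by move=> y _; exact: initial_continuous.
    + by rewrite /= in_itv/= !f_lt'; apply/andP; split; lra.
    + move=> y; rewrite /= in_itv/=; have /f_onto[t' ty] : a < \val y < b.
        by have := set_mem (valP y); rewrite /= in_itv.
      rewrite -[X in _ < X < _]/(\val y) -ty.
      by rewrite !f_lt' -ltr_distl => tt'; exists t' => //; exact: rhoE.
apply/seteqP; split=> x [].
  by move=> t _ <-; exists (rho t).
move=> y _ <-; have /f_onto[t ty] : a < \val y < b.
  by have := set_mem (valP y); rewrite /= in_itv.
by exists t => //=; rewrite (rhoE y).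
Qed.

Lemma line_chart_punctured_circle (R : realType) (d : nat)
    (sigma : unit_circle R -> 'rV[R]_d) (q : unit_circle R) :
  embedding sigma ->
  exists2 gamma, line_chart (range sigma) gamma &
    range gamma = range sigma `\ sigma q.
Proof.
move=> se; case: q => -[q1 q2] qC.
have q12 : q1 ^+ 2 + q2 ^+ 2 = 1 by have := set_mem qC.
pose w1 t : R := (1 - t ^+ 2) / (1 + t ^+ 2).
pose w2 t : R := 2 * t / (1 + t ^+ 2).
have D0 (t : R) : 1 + t ^+ 2 != 0 by rewrite gt_eqF// ltr_pwDl// sqr_ge0.
have w12 t : w1 t ^+ 2 + w2 t ^+ 2 = 1 by rewrite /w1 /w2; field.
have w1N t : 1 + w1 t = 2 / (1 + t ^+ 2) by rewrite /w1; field.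
have w1N0 t : 0 < 1 + w1 t by rewrite w1N divr_gt0// ltr_pwDl// sqr_ge0.
have w2E t : w2 t = t * (1 + w1 t) by rewrite w1N /w2; field.
(* Inverse stereographic projection from -1, then the rotation from -1 to q. *)
pose f t := (- q1 * w1 t + q2 * w2 t, - q2 * w1 t + - q1 * w2 t).
have fI t : f t \in unit_circle R.
  apply: mem_set; rewrite /unit_circle/= -[RHS](w12 t).
  by rewrite -[RHS]mul1r -q12; ring.
(* [v1] and [v2] undo the rotation; on the circle, [1 + v1] vanishes only at the removed point. *)
pose v1 (z : R * R) := - (q1 * z.1 + q2 * z.2).
pose v2 (z : R * R) := q2 * z.1 - q1 * z.2.
have v1f t : v1 (f t) = w1 t by rewrite /v1/= -[RHS]mul1r -q12; ring.
have v2f t : v2 (f t) = w2 t by rewrite /v2/= -[RHS]mul1r -q12; ring.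
have v12 z : unit_circle R z -> v1 z ^+ 2 + v2 z ^+ 2 = 1.
  by rewrite /unit_circle/= => zC; rewrite -[RHS]zC -[RHS]mul1r -q12 /v1 /v2;
    ring.
have vz z : z = (- q1 * v1 z + q2 * v2 z, - q2 * v1 z + - q1 * v2 z).
  by case: z => x y; rewrite /v1 /v2/=; congr pair; rewrite -[LHS]mul1r -q12;
    ring.
have inv x y : x ^+ 2 + y ^+ 2 = 1 -> 1 + x != 0 ->
    w1 (y / (1 + x)) = x /\ w2 (y / (1 + x)) = y.
  move=> xy x0; have tt : 1 + (y / (1 + x)) ^+ 2 = 2 / (1 + x).
    have -> : 1 + (y / (1 + x)) ^+ 2 = (1 + 2 * x + (x ^+ 2 + y ^+ 2)) / (1 +
      x) ^+ 2.
      by field.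
    by rewrite xy; field.
  by rewrite w2E -[w1 _](addKr 1) w1N tt; split; field.
have f_onto z : unit_circle R z -> 1 + v1 z != 0 -> f (v2 z / (1 + v1 z)) = z.
  by move=> /v12/inv zC /zC[E1 E2]; rewrite [RHS]vz /f E1 E2.
have v1q z : unit_circle R z -> 1 + v1 z = 0 -> z = (q1, q2).
  move=> zC /eqP; rewrite addrC addr_eq0 => /eqP z1; have := v12 z zC.
  rewrite z1 sqrrN expr1n => /eqP; rewrite -subr_eq0 addrAC subrr add0r
    sqrf_eq0 => /eqP z2.
  by rewrite [LHS]vz z1 z2; congr pair; ring.
have cont (a b : R) : continuous (fun z : R * R => a * z.1 + b * z.2).
  move=> z; apply: cvgD; apply: cvgMr; [exact: cvg_fst|exact: cvg_snd].
have v1c : continuous v1 by move=> z; apply: cvgN; exact: cont.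
have v2c : continuous v2.
  have -> : v2 = fun z : R * R => q2 * z.1 + (- q1) * z.2.
    by apply/funext => z; rewrite /v2 mulNr.
  exact: cont.
have wc : continuous w1 /\ continuous w2.
  have sqc : continuous (fun t : R => t ^+ 2) by move=> t;
    exact: exprn_continuous.
  have Dc : continuous (fun t : R => (1 + t ^+ 2)^-1).
    by move=> t; apply: cvgV => //; apply: cvgD; [exact: cvg_cst|exact: sqc].
  split=> t; apply: cvgM (Dc t).
    by apply: cvgB; [exact: cvg_cst|exact: sqc].
  by apply: cvgM; [exact: cvg_cst|exact: cvg_id].
have fc : continuous f.
  have lin (a b : R) : continuous (fun t => a * w1 t + b * w2 t).
    move=> t; apply: cvgD; apply: cvgM; first [exact: cvg_cst|exact:
      wc.1|exact: wc.2].
  by move=> t; exact: (cvg_pair (lin (- q1) q2 t) (lin (- q2) (- q1) t)).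
pose rho t : unit_circle R := exist _ (f t) (fI t).
have rhoE (y : unit_circle R) t : f t = \val y -> rho t = y.
  by move=> E; apply: val_inj.
have f_inj : injective f.
  move=> s t E; apply: (mulIf (lt0r_neq0 (w1N0 t))); rewrite -w2E.
  by have := v1f s; have := v2f s; rewrite E v1f v2f w2E => -> ->.
exists (sigma \o rho).
  apply: line_chart_embedding => //.
  - exact: continuous_comp_initial.
  - by move=> s t /(congr1 \val)/f_inj.
  - move=> t e e0.
    (* The condition that the stereographic parameter [v2 z / (1 + v1 z)] is within [e] of [t],
       multiplied out so as to be visibly open; it forces [1 + v1 z] to be positive. *)
    exists (\val @^-1` [set z | `|v2 z - t * (1 + v1 z)| < e * (1 + v1 z)]);
      split.
    + apply: open_comp; first by move=> y _; exact: initial_continuous.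
      have -> : [set z | `|v2 z - t * (1 + v1 z)| < e * (1 + v1 z)] =
          (fun z => e * (1 + v1 z) - `|v2 z - t * (1 + v1 z)|) @^-1` [set x | 0
            < x].
        by apply/seteqP; split=> z /=; rewrite subr_gt0.
      apply: open_comp; last exact: open_gt.
      have vc (k : R) : continuous (fun z => k * (1 + v1 z)).
        move=> z; apply: cvgM; first exact: cvg_cst.
        by apply: cvgD; [exact: cvg_cst|exact: v1c].
      move=> z _; apply: cvgB; first exact: vc.
      by apply: cvg_norm; apply: cvgB; [exact: v2c|exact: vc].
    + by rewrite /= v1f v2f w2E subrr normr0 mulr_gt0.
    + move=> y /=; have yC := set_mem (valP y).
      rewrite -/(\val y) => ty.
      have y0 : 0 < 1 + v1 (\val y).
        by rewrite -(pmulr_rgt0 _ e0) (le_lt_trans _ ty).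
      exists (v2 (\val y) / (1 + v1 (\val y))).
        by apply: rhoE; apply: f_onto => //; rewrite gt_eqF.
      have -> : v2 (\val y) / (1 + v1 (\val y)) - t =
          (v2 (\val y) - t * (1 + v1 (\val y))) / (1 + v1 (\val y)).
        by rewrite [RHS]mulrBl mulfK// gt_eqF.
      by rewrite normrM normfV (gtr0_norm y0) ltr_pdivrMr.
apply/seteqP; split=> x.
  move=> [t _ <-]; split; first by exists (rho t).
  case: se => _ si _ /= /si/(congr1 \val)/= ft.
  have := w1N0 t; rewrite -v1f ft /v1/=.
  have -> : q1 * q1 + q2 * q2 = 1 by rewrite -q12; ring.
  by rewrite subrr ltxx.
move=> [[y _ <-] yq]; have yC := set_mem (valP y).
have y0 : 1 + v1 (\val y) != 0.
  by apply/eqP => /(v1q _ yC) yE; apply: yq; congr sigma; exact: val_inj.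
by exists (v2 (\val y) / (1 + v1 (\val y))) => //=; rewrite (rhoE y)// f_onto.
Qed.

(** On a closed curve the removed point can be chosen outside the finite list [X], because the curve
    is infinite. *)
Lemma exists_line_chart (R : realType) (d : nat) (K : set 'rV[R]_d)
    (X : seq 'rV[R]_d) : curve K ->
  exists2 gamma, line_chart K gamma &
    {in X, forall x, K x -> exists t, gamma t = x}.
Proof.
case=> [[sigma se <-]|[a [b [sigma [ab se <-]]]]]; last first.
  have [gamma gc gK] := line_chart_interval ab se.
  by exists gamma => // x _; rewrite -gK => -[t _ <-]; exists t.
have C1 : (1, 0) \in unit_circle R.
  by apply: mem_set; rewrite /unit_circle/= expr1n expr0n addr0.
(* A first chart, punctured at the image of (1, 0), supplies more than [size X] distinct points of
   the curve. *)
have [q qX] : exists q, sigma q \notin X.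
  have [gamma [_ gi gK _] _] := line_chart_punctured_circle (exist (fun z => z
    \in unit_circle R) _ C1) se.
  pose s := [seq gamma i%:R | i <- iota 0 (size X).+1].
  have us : uniq s.
    rewrite map_inj_uniq ?iota_uniq// => i j /gi/eqP.
    by rewrite eqr_nat => /eqP.
  have /allPn[_ /mapP[i _ ->] iX] : ~~ all (mem X) s.
    apply/negP => /allP sX; have := uniq_leq_size us sX.
    by rewrite size_map size_iota ltnn.
  by have [q _ qE] := gK i%:R; exists q; rewrite qE.
have [gamma gc gK] := line_chart_punctured_circle q se.
exists gamma => // x xX Kx; have : range gamma x.
  by rewrite gK; split=> // xq; rewrite -xq xX in qX.
by case=> t _ <-; exists t.
Qed.

(** * Few zeros imply convexity *)

Lemma few_zeros_line_chart (R : realType) (d : nat) (K : set 'rV[R]_d) gamma :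
  line_chart K gamma -> few_zeros (affine_basis (fun x : K => \val x)) ->
  few_zeros (affine_basis gamma).
Proof.
move=> [_ gi gK _] few c c0 s us cs.
pose g t : K := exist _ (gamma t) (mem_set (gK t)).
rewrite -(size_map g); apply: few c0 _ _ _.
  by rewrite map_inj_uniq// => x y /(congr1 \val)/gi.
by move=> _ /mapP[t /cs ct ->]; rewrite -[RHS]ct !lincomb_affineE.
Qed.

(** Points of [K] near [gamma t] have parameters near [t], so [m.+1] of them on a nearby hyperplane
    would be [m.+1] zeros of a nearby combination. *)
Lemma multiplicity_le (R : realType) (d : nat) (K : set 'rV[R]_d) gamma a b t m
  :
  line_chart K gamma -> `|a| = 1 ->
  ~ mult_ge (affine_basis gamma) (level_coef a b) t m.+1 ->
  (multiplicity K (level_set a b) (gamma t) <= m%:R%:E)%E.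
Proof.
move=> [_ gi _ gK] a1 /existsNP[e /not_implyP[e0 noc]].
have [r r0 rK] := gK t e e0.
apply: ge_ereal_inf; exists (ereal_sup [set counting (K `&` H' `&` ball (gamma
  t) r) |
    H' in perturbation e (level_set a b)]).
  by exists r => //; exists e.
apply: ge_ereal_sup => _ [_ [a2 [a' [b2 [b' [[a21 a'1] Hab -> aa' bb']]]]] <-].
apply: counting_le => s us sA; rewrite leqNgt; apply/negP => ms.
(* The perturbation may start from the opposite equation of the same hyperplane; dividing by [k]
   brings the new equation close to that of [a] and [b]. *)
have [k [k1 a2E b2E]] := level_set_inj a1 a21 Hab.
have k0 : k != 0 by rewrite -normr_gt0 k1.
apply: noc; exists (level_coef (k^-1 *: a') (k^-1 * b')).
  apply: level_coefB_lt => //.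
    rewrite (_ : _ - a = k^-1 *: (a' - a2)) ?normrZ ?normfV ?k1 ?invr1 ?mul1r//.
    by rewrite scalerBr a2E scalerA mulVf// scale1r.
  rewrite (_ : _ - b = k^-1 * (b' - b2)) ?normrM ?normfV ?k1 ?invr1 ?mul1r//.
  by rewrite mulrBr b2E mulKf.
have /choice[tau tauP] : forall x, exists t', x \in s -> gamma t' = x /\ `|t' -
  t| < e.
  move=> x; have [xs|] := boolP (x \in s); last by exists 0.
  have [[Kx _] xr] := sA x xs; have [|t' tx tt'] := rK x Kx; last by exists t'.
  by move: xr; rewrite mx_norm_ball /ball_/= distrC.
exists [seq tau x | x <- take m.+1 s]; split.
- rewrite map_inj_in_uniq ?take_uniq// => x y /mem_take xs /mem_take ys txy.
  by have [<- _] := tauP x xs; have [<- _] := tauP y ys; rewrite txy.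
- by rewrite size_map size_takel.
- move=> _ /mapP[x /mem_take xs ->]; have [tx te] := tauP x xs; split=> //.
  apply/lincomb_level_coef; rewrite level_setZ ?invr_eq0// tx.
  by have [[_ ?] _] := sA x xs.
Qed.

Lemma few_zeros_convex (R : realType) (d : nat) (K : set 'rV[R]_d) :
  curve K -> few_zeros (affine_basis (fun x : K => \val x)) -> convex_curve K.
Proof.
move=> cK few H /hyperplane_eq_level_set[a [b [a1 ->]]].
(* The sum is a supremum over finite sets, and the points of a finite set are covered by one
   chart. *)
apply: ge_ereal_sup => _ [X [fX XK] <-]; rewrite fsbig_finite//.
set s := enum_fset _.
have sX x : x \in s -> K x /\ level_set a b x.
  move=> xs; apply: XK; have : x \in fset_set X by [].
  by rewrite in_fset_set// => /set_mem.
have [gamma gch gX] := exists_line_chart s cK.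
have gfew := few_zeros_line_chart gch few; have [gc _ _ _] := gch.
have gcont j : continuous (affine_basis gamma j) by exact:
  continuous_affine_basis.
set c := level_coef a b.
have c0 : c != 0.
  have : a != 0 by rewrite -normr_gt0 a1.
  apply: contra_neq => /rowP c0; apply/rowP => i.
  by have := c0 (lift ord0 i); rewrite /c !mxE liftK.
have /choice[tau tauP] : forall x, exists t, x \in s -> gamma t = x.
  move=> x; have [xs|] := boolP (x \in s); last by exists 0.
  by have [Kx _] := sX x xs; have [t tx] := gX x xs Kx; exists t.
(* A largest multiplicity exists, as otherwise a single zero would have multiplicity [d.+1], against
   [sum_mult_lt]. *)
have /choice[m mP] : forall t, exists m, mult_ge (affine_basis gamma) c t m /\
    ~ mult_ge (affine_basis gamma) c t m.+1.
  move=> t; apply: contrapT => /forallNP nom.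
  have all_m n : mult_ge (affine_basis gamma) c t n.
    elim: n => [|n IH]; last by apply: contrapT => ?; exact: (nom n).
    by move=> e e0; exists c; [rewrite subrr normr0|exists [::]].
  suff : (\sum_(p <- [:: t]) d.+1 < d.+1)%N by rewrite big_seq1 ltnn.
  by apply: (sum_mult_lt gcont gfew c0) => // p; rewrite inE => /eqP->.
have tauK : {in s &, injective tau}.
  by move=> x y xs ys txy; rewrite -(tauP x xs) txy tauP.
have : (\sum_(p <- map tau s) m p < d.+1)%N.
  apply: (sum_mult_lt gcont gfew c0); first by rewrite map_inj_in_uniq
    ?fset_uniq.
  by move=> p _; have [] := mP p.
rewrite big_map ltnS -(ler_nat R) -lee_fin; apply: le_trans.
rewrite natr_sum -sumEFin big_seq [X in (_ <= X)%E]big_seq;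
  apply: lee_sum => x xs.
rewrite -{1}(tauP x xs); apply: multiplicity_le => //.
by have [] := mP (tau x).
Qed.

Theorem theorem4 (R : realType) (d : nat) (K : set 'rV[R]_d)
    (curveK : curve K)
    (K_not_in_hyperplane :
       forall H : set 'rV[R]_d, hyperplane H -> ~ subset K H) :
  Chebyshev_space (poly_restr 1 K) <-> convex_curve K.
Proof.
have K0 : K !=set0.
  by have [gamma [_ _ gK _] _] := exists_line_chart [::] curveK;
    exists (gamma 0).
apply: iff_trans (Chebyshev_affine K0 K_not_in_hyperplane) _.
by split; [exact: few_zeros_convex|exact: convex_few_zeros].
Qed.
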